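(* Let $(R,\mathfrak m,K)$ be a local ring and let $M$ be an $R$-module of finite length and infinite projective dimension whose Betti numbers are eventually non-decreasing (i.e. $\beta_{i+1}(M)\ge\beta_i(M)$ for all $i\gg 0$). Then, for all $i\gg 0$, there exists a minimal prime $\mathfrak p$ of $R$ such that $\dim(\Omega_i(M))=\dim(R/\mathfrak p)$. In particular, $M$ cannot have arbitrarily high syzygies of finite length.
   Context: Rings are commutative and Noetherian. For a minimal free resolution $\cdots\to G_1\xrightarrow{\varphi_1}G_0\to M\to 0$ of $M$ (finitely generated free modules, $\operatorname{Im}(\varphi_{j+1})\subseteq\mathfrak mG_j$), $\beta_i(M)=\operatorname{rank}(G_i)$ is the $i$-th Betti number, and the syzygies are $\Omega_0(M)=M$ and $\Omega_i(M)=\operatorname{Im}(\varphi_i)\subseteq G_{i-1}$ for $i\ge1$. For a finitely generated $R$-module $N$, $\dim(N)=\dim(R/\operatorname{ann}_R(N))$, with $\dim(0)=-1$.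
   Formalization: The final claim, that M cannot have arbitrarily high syzygies of finite length, is stated only for dim R > 0; it fails whenever dim R = 0, e.g. for R = K[x]/(x^2) and M = K, where every syzygy is isomorphic to K. *)

(* Defs.v *)
From HB Require Import structures.
From mathcomp Require Import all_boot all_order all_algebra.
From mathcomp Require Import ring_quotient.
From mathcomp Require Import boolp classical_sets constructive_ereal.

Set Implicit Arguments.
Unset Strict Implicit.
Unset Printing Implicit Defensive.

Import Order.TTheory GRing.Theory Num.Theory.

Local Open Scope classical_set_scope.
Local Open Scope ring_scope.

(* Ideals are classical sets [set R]; the library closure predicates
    are applied to the associated boolean predicate [[in I]].  Note that
    [idealr_closed] includes [1 \notin I]: it describes proper ideals. *)

Definition is_proper_ideal (R : comNzRingType) (I : set R) : Prop :=
  idealr_closed [in I].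

Definition prime_ideal (R : comNzRingType) (P : set R) : Prop :=
  is_proper_ideal P /\ prime_idealr_closed [in P].

Definition maximal_ideal (R : comNzRingType) (m : set R) : Prop :=
  is_proper_ideal m /\ forall I : set R, is_proper_ideal I -> m `<=` I -> I = m.

Definition minimal_prime (R : comNzRingType) (p : set R) : Prop :=
  prime_ideal p /\ forall q : set R, prime_ideal q -> q `<=` p -> q = p.

Definition local_ring (R : comNzRingType) (m : set R) : Prop :=
  maximal_ideal m /\ forall n : set R, maximal_ideal n -> n = m.

Definition submodule (R : comNzRingType) (V : lmodType R) (N : set V) : Prop :=
  submod_closed [in N].

(* Ideals, including the unit ideal, are the submodules of [R^o]. *)
Definition noetherian_ring (R : comNzRingType) : Prop :=
  forall I : set R^o, submodule I ->
    exists (n : nat) (g : 'I_n -> R^o),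
      I = range (fun c : 'I_n -> R => \sum_(i < n) c i *: g i).

Definition ideal_mul (R : comNzRingType) (V : lmodType R) (I : set R) : set V :=
  [set x | exists (n : nat) (a : 'I_n -> R) (v : 'I_n -> V),
     (forall i, I (a i)) /\ x = \sum_(i < n) a i *: v i].

Definition prime_chain (R : comNzRingType) (n : nat) (P : nat -> set R) : Prop :=
  (forall i, (i <= n)%N -> prime_ideal (P i)) /\
  (forall i, (i < n)%N -> P i `<` P i.+1).

Definition krull_dim (R : comNzRingType) : \bar int :=
  supremum (-1)%:E
    [set n%:Z%:E | n in [set n : nat | exists P : nat -> set R, prime_chain n P]].

Definition ideal_pred (R : comNzRingType) (I : set R) (hI : is_proper_ideal I) :
  R -> bool := [in I].

HB.instance Definition _ (R : comNzRingType) (I : set R) (hI : is_proper_ideal I) :=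
  isIdealr.Build R (ideal_pred hI) hI.

(* dim (R / I).  The library quotient {ideal_quot _} is a nonzero ring, hence
   needs a proper ideal; -1 is the dimension of the zero ring R / R. *)
Definition dim_quot (R : comNzRingType) (I : set R) : \bar int :=
  if pselect (is_proper_ideal I) is left hI
  then krull_dim {ideal_quot (ideal_pred hI : idealr R)} else (-1)%:E.

Definition ann (R : comNzRingType) (V : lmodType R) (N : set V) : set R :=
  [set a | forall x, N x -> a *: x = 0].

(* If N = 0 then ann N = R, so that dim_mod N = -1. *)
Definition dim_mod (R : comNzRingType) (V : lmodType R) (N : set V) : \bar int :=
  dim_quot (ann N).

(* Existence of a composition series. *)
Definition finite_length (R : comNzRingType) (V : lmodType R) (N : set V) : Prop :=
  exists (n : nat) (C : nat -> set V),
    [/\ C 0%N = [set 0], C n = N,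
        forall i, (i <= n)%N -> submodule (C i) &
        forall i, (i < n)%N -> C i `<` C i.+1 /\
          forall L : set V, submodule L -> C i `<=` L -> L `<=` C i.+1 ->
            L = C i \/ L = C i.+1].

Record resolution (R : comNzRingType) (M : lmodType R) := Resolution {
  term : nat -> lmodType R;
  diff : forall i, {linear term i.+1 -> term i};  (* $\varphi_{i+1}$ *)
  aug : {linear term 0%N -> M};
  aug_surj : range aug = [set: M];
  aug_exact : range (diff 0%N) = [set x | aug x = 0];
  diff_exact : forall i, range (diff i.+1) = [set x | diff i x = 0]
}.

Definition projective (R : comNzRingType) (P : lmodType R) : Prop :=
  forall (A B : lmodType R) (f : {linear A -> B}) (g : {linear P -> B}),
    range f = [set: B] -> exists h : {linear P -> A}, forall x, f (h x) = g x.

Definition finite_proj_dim (R : comNzRingType) (M : lmodType R) : Prop :=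
  exists (F : resolution M) (n : nat),
    (forall i, projective (term F i)) /\
    (forall i, (n < i)%N -> [set: term F i] = [set 0]).

Definition free_of_rank (R : comNzRingType) (G : lmodType R) (n : nat) : Prop :=
  exists f : {linear 'rV[R]_n -> G}, bijective f.

(* F is a minimal free resolution of M over a local ring with maximal ideal m,
   and beta i is the rank of its i-th term, i.e. the i-th Betti number of M. *)
Definition minimal_free_resolution (R : comNzRingType) (m : set R)
    (M : lmodType R) (F : resolution M) (beta : nat -> nat) : Prop :=
  (forall i, free_of_rank (term F i) (beta i)) /\
  (forall i, range (diff F i) `<=` ideal_mul m).

(* $\Omega_0(M) = M$ and $\Omega_{i+1}(M) \subseteq G_i$ live in different
   modules. *)
Definition syz_ambient (R : comNzRingType) (M : lmodType R) (F : resolution M)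
    (i : nat) : lmodType R :=
  if i is j.+1 then term F j else M.

Definition syzygy (R : comNzRingType) (M : lmodType R) (F : resolution M)
    (i : nat) : set (syz_ambient F i) :=
  match i return set (syz_ambient F i) with
  | 0%N => [set: M]
  | j.+1 => range (diff F j)
  end.

Arguments syzygy {R M} F i _.

(* Main.v *)
(* Away from the closed point the minimal resolution F of M becomes split exact,
   because each s in m has a power killing M, and multiplication by that power is
   null-homotopic on F.  Over the residue field of any prime p <> m the rank of the
   differential with image Omega_{i+1} is therefore the alternating sum
   r_i = beta_i - beta_{i-1} + ..., independently of p.  If r_i > 0, the annihilator
   of Omega_{i+1} lies in every minimal prime, and Omega_{i+1} has the dimension of
   R/p for some minimal prime p.  If r_i = 0, a power of each s in m kills Omega_{i+1}.

   Since r_{i+1} + r_i = beta_{i+1}, monotonicity of beta gives r_i <= r_{i+2} for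
   large i, so if r vanishes infinitely often, it vanishes along a whole parity
   class.  For such i the differential phi between Omega_{i+3} = ker phi and
   Omega_{i+1} = coker phi is an endomorphism of R^b with b > 0.  With T the m-power
   torsion of R^b, phi^{-1}(T) = T, hence
   length (ker phi) = length (T / phi T) = length ((im phi + T) / im phi)
   < length (coker phi), the last step because im phi + T lies in m R^b.  So the
   lengths of Omega_{i+1}, Omega_{i+3}, ... strictly decrease, which is absurd. *)

Require Import Defs.
From HB Require Import structures.
From mathcomp Require Import all_boot all_order all_algebra.
From mathcomp Require Import ring_quotient fraction.
From mathcomp Require Import boolp classical_sets constructive_ereal.
Set Implicit Arguments.
Unset Strict Implicit.
Unset Printing Implicit Defensive.
Import Order.TTheory GRing.Theory Num.Theory.
Local Open Scope classical_set_scope.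
Local Open Scope ring_scope.

(** * Submodules and ideals *)

Lemma submoduleP (R : comNzRingType) (V : lmodType R) (N : set V) :
  submodule N <-> N 0 /\ forall a u v, N u -> N v -> N (a *: u + v).
Proof.
rewrite /submodule; split.
  case=> /set_mem N0 Nl; split=> // a u v Nu Nv.
  by apply/set_mem/Nl; apply/mem_set.
case=> N0 Nl; split; first exact/mem_set.
by move=> a u v /set_mem Nu /set_mem Nv; apply/mem_set/Nl.
Qed.

Section Submodules.
Variables (R : comNzRingType) (V : lmodType R).
Implicit Types (N : set V) (I : set R).

Lemma sub0m N : submodule N -> N 0.
Proof. by case/submoduleP. Qed.

Lemma submD N u v : submodule N -> N u -> N v -> N (u + v).
Proof. by case/submoduleP=> _ Nl Nu Nv; rewrite -[u]scale1r; apply: Nl. Qed.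

Lemma submZ N a u : submodule N -> N u -> N (a *: u).
Proof. by case/submoduleP=> N0 Nl Nu; rewrite -[_ *: _]addr0; apply: Nl. Qed.

Lemma submB N u v : submodule N -> N u -> N v -> N (u - v).
Proof. by move=> sN Nu Nv; rewrite -scaleN1r; apply: submD => //; apply: submZ. Qed.

Lemma subm_sum N (J : Type) (r : seq J) (P : pred J) (f : J -> V) :
  submodule N -> (forall j, P j -> N (f j)) -> N (\sum_(j <- r | P j) f j).
Proof.
move=> sN Nf; elim/big_ind: _ => //; first exact: sub0m.
by move=> u v; apply: submD.
Qed.

Lemma generator_mem n (g : 'I_n -> V) i :
  range (fun c : 'I_n -> R => \sum_(j < n) c j *: g j) (g i).
Proof.
exists (fun j => (j == i)%:R) => //.
rewrite (bigD1 i) //= eqxx scale1r big1 ?addr0 // => j /negPf ->.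
by rewrite scale0r.
Qed.

Definition addspan N (x : V) : set V := [set v | exists2 a, N a & exists r, v = a + r *: x].

Lemma addspan_sub N x : N `<=` addspan N x.
Proof. by move=> a Na; exists a => //; exists 0; rewrite scale0r addr0. Qed.

Lemma addspan_mem N x : submodule N -> addspan N x x.
Proof. by move=> /sub0m N0; exists 0 => //; exists 1; rewrite scale1r add0r. Qed.

Lemma addspan_submodule N x : submodule N -> submodule (addspan N x).
Proof.
move=> sN; apply/submoduleP; split; first by apply: addspan_sub; apply: sub0m.
move=> b u v [u' Nu' [r ->]] [v' Nv' [t ->]].
exists (b *: u' + v'); first by apply: submD => //; apply: submZ.
by exists (b * r + t); rewrite scalerDr scalerA scalerDl addrACA.
Qed.

Lemma addspan_min N L x : submodule L -> N `<=` L -> L x -> addspan N x `<=` L.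
Proof. by move=> sL NL Lx _ [a Na [r ->]]; apply: submD (submZ _ _ _) => //; apply: NL. Qed.

End Submodules.

Section Ideals.
Variable R : comNzRingType.
Implicit Types (I P : set R).

Lemma idealP I : is_proper_ideal I <-> submodule (I : set R^o) /\ ~ I 1.
Proof.
split.
  move=> [/set_mem I0 /negP I1 Il]; split; last by move=> /mem_set.
  by apply/submoduleP; split=> // a u v Iu Iv; apply/set_mem/Il; apply/mem_set.
move=> [/submoduleP[I0 Il] I1]; split; first exact/mem_set.
  by apply/negP => /set_mem.
by move=> a u v /set_mem Iu /set_mem Iv; apply/mem_set/Il.
Qed.

Lemma primeP P : prime_ideal P <->
  [/\ submodule (P : set R^o), ~ P 1 & forall a b, P (a * b) -> P a \/ P b].
Proof.
rewrite /prime_ideal idealP; split.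
  move=> [[sP P1] Pp]; split=> // a b /mem_set /Pp /orP[] /set_mem; by [left|right].
move=> [sP P1 Pp]; do !split=> //.
by move=> a b /set_mem /Pp[] /mem_set ->; rewrite ?orbT.
Qed.

Lemma idealM I a x : submodule (I : set R^o) -> I x -> I (a * x).
Proof. by move=> sI; apply: (@submZ _ R^o). Qed.

Lemma primeX P x k : prime_ideal P -> P (x ^+ k) -> P x.
Proof.
move=> /primeP[_ P1 Pp]; elim: k => [/P1 //|k IH].
by rewrite exprS => /Pp[].
Qed.

Lemma submodule0 (V : lmodType R) : submodule [set (0 : V)].
Proof. by apply/submoduleP; split=> //= a u v -> ->; rewrite scaler0 addr0. Qed.

Lemma submoduleT (V : lmodType R) : submodule [set: V].
Proof. by apply/submoduleP. Qed.

(** * Noetherian induction and primes avoiding the powers of an element *)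

Section Noetherian.
Hypothesis noethR : noetherian_ring R.

(** A counterexample would start, by choice, a strictly ascending chain of counterexamples; the
    union of the chain is finitely generated, so it is reached at a finite stage. *)
Lemma noetherian_ind (T : set R -> Prop) :
  (forall I : set R^o, submodule I ->
     (forall J : set R^o, submodule J -> I `<` J -> T J) -> T I) ->
  forall I : set R^o, submodule I -> T I.
Proof.
move=> step I0 sI0; apply: contrapT => nTI0.
pose bad := {I : set R^o | submodule I & ~ T I}.
have next (I : bad) : {J : bad | s2val I `<` s2val J}.
  case: I => I sI nT; apply: cid => /=; apply: contrapT => none.
  apply/nT/step => // J sJ IJ; apply: contrapT => nTJ.
  by apply: none; exists (exist2 _ _ J sJ nTJ).
pose ch := fix ch n : bad := if n is k.+1 then sval (next (ch k)) else exist2 _ _ I0 sI0 nTI0.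
have chS n : s2val (ch n) `<` s2val (ch n.+1) := svalP (next (ch n)).
have chle a b : (a <= b)%N -> s2val (ch a) `<=` s2val (ch b).
  move/subnKC <-; elim: (b - a)%N => [|k IH]; first by rewrite addn0.
  by rewrite addnS; apply: subset_trans IH _; case: (chS (a + k)%N).
pose U : set R^o := [set x | exists n, s2val (ch n) x].
have sch n : submodule (s2val (ch n)) := s2valP (ch n).
have sU : submodule U.
  apply/submoduleP; split; first by exists 0; apply: sub0m.
  move=> a u v [j ju] [l lv]; exists (maxn j l).
  apply: submD => //; first apply: submZ => //; last exact: chle (leq_maxr _ _) _ lv.
  exact: chle (leq_maxl _ _) _ ju.
have [n [g gen]] := noethR sU.
have Ug i : U (g i) by rewrite gen; apply: generator_mem.
have [f fP] := choice Ug.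
pose t := \max_i f i.
have : s2val (ch t.+1) `<=` s2val (ch t).
  move=> x chx; have : U x by exists t.+1.
  rewrite gen => -[c _ <-]; apply: subm_sum => // i _.
  by apply: submZ => //; apply: chle (fP i); apply: leq_bigmax.
by case: (chS t) => ? /[apply].
Qed.

(** If [a * b] is in [I] and powers of [s] lay in both [I + (a)] and [I + (b)], their product would
    lie in [I]. So one of these ideals again avoids the powers of [s], and Noetherian induction
    replaces Zorn's lemma. *)
Lemma prime_avoiding s : forall I : set R^o, submodule I ->
  (forall k, ~ I (s ^+ k)) -> exists P : set R, [/\ prime_ideal P, I `<=` P & ~ P s].
Proof.
apply: noetherian_ind => I sI IH nI.
have [pI|npI] := pselect (prime_ideal I).
  by exists I; split => // Is; apply: (nI 1%N); rewrite expr1.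
have /existsNP[a /existsNP[b]] : ~ forall a b, I (a * b) -> I a \/ I b.
  by move=> Ip; apply: npI; apply/primeP; split=> //; exact: (nI 0%N).
move=> /not_implyP[Iab /not_orP[nIa nIb]].
have IHa x : ~ I x -> (forall k, ~ addspan I x (s ^+ k)) ->
    exists P : set R, [/\ prime_ideal P, I `<=` P & ~ P s].
  move=> nIx nk; have [|P [pP IP Ps]] := IH _ (addspan_submodule x sI) _ nk.
    split; first exact: addspan_sub.
    by move=> sub; apply/nIx/sub/addspan_mem.
  by exists P; split=> //; apply: subset_trans IP; apply: addspan_sub.
have [/existsNP[j /contrapT [c Ic [r jE]]]|] :=
    pselect (~ forall k, ~ addspan I a (s ^+ k)); last by move=> /contrapT /IHa; apply.
have [/existsNP[l /contrapT [d Id [t lE]]]|] :=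
    pselect (~ forall k, ~ addspan I b (s ^+ k)); last by move=> /contrapT /IHa; apply.
case: (nI (j + l)%N); rewrite exprD jE lE /GRing.scale /= mulrDr mulrDl.
rewrite -addrA; apply: (@submD _ R^o) => //; last apply: (@submD _ R^o) => //.
- by rewrite mulrC; apply: idealM.
- exact: idealM.
- by rewrite mulrDl mulrACA [c * _]mulrC; apply: (@submD _ R^o) => //; apply: idealM.
Qed.

End Noetherian.
End Ideals.

(** * Local rings and residue fields *)

Section Local.
Variables (R : comNzRingType) (m : set R).
Hypothesis noethR : noetherian_ring R.

Lemma maximal_ideal_exists : forall I : set R^o, submodule I -> ~ I 1 ->
  exists n, maximal_ideal n /\ I `<=` n.
Proof.
apply: noetherian_ind => // I sI IH I1.
have [mI|] := pselect (maximal_ideal (I : set R)); first by exists I; split=> // x.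
move=> /not_andP[|]; first by case; apply/(idealP I); split.
move=> /existsNP[J /not_implyP[/idealP[sJ J1] /not_implyP[IJ JI]]].
have [||n [mn Jn]] := IH J sJ => //.
  by split=> // subJ; apply: JI; apply/seteqP.
by exists n; split=> //; apply: subset_trans Jn.
Qed.

Hypothesis localR : local_ring m.

Lemma local_sub (I : set R^o) : submodule I -> ~ I 1 -> I `<=` m.
Proof.
by move=> sI /(maximal_ideal_exists sI)[n [/(proj2 localR) ->]].
Qed.

Lemma local_submodule : submodule (m : set R^o).
Proof. by case: localR => -[/idealP[]]. Qed.

Lemma local_proper : ~ m 1.
Proof. by case: localR => -[/idealP[]]. Qed.

Lemma local_unit r : ~ m r -> exists u, u * r = 1.
Proof.
move=> nmr; pose I : set R^o := addspan [set 0] (r : R^o).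
have sI : submodule I := addspan_submodule _ (submodule0 _).
have [[_ -> [u]]|nI1] := pselect (I 1); first by rewrite add0r; exists u.
by case: nmr; apply: (local_sub sI nI1); apply: addspan_mem; apply: submodule0.
Qed.

Lemma local_unit1B s : m s -> exists u, u * (1 - s) = 1.
Proof.
move=> ms; apply: local_unit => m1s; apply: local_proper.
by rewrite -[1](subrK s); apply: (@submD _ R^o) => //; apply: local_submodule.
Qed.

Lemma prime_sub_local P : prime_ideal P -> P `<=` m.
Proof. by move=> /primeP[sP P1 _]; apply: local_sub. Qed.

Lemma prime_neq_local P : prime_ideal P -> P <> m -> exists2 s, m s & ~ P s.
Proof.
move=> pP Pm; apply: contrapT => none; apply: Pm; apply/seteqP; split.
  exact: prime_sub_local.
by move=> s ms; apply: contrapT => nPs; apply: none; exists s.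
Qed.

(** The maximal ideal kills every composition factor, so the number of factors serves as
    exponent. *)
Lemma finite_length_torsion (V : lmodType R) (N : set V) s :
  finite_length N -> m s -> exists k, forall x, N x -> s ^+ k *: x = 0.
Proof.
move=> [n [C [C0 Cn sC simple]]] ms; exists n; rewrite -Cn.
elim: {-2}n (leqnn n) => [|i IH] ltin x Cx; first by rewrite C0 in Cx; rewrite Cx scaler0.
have sCi := sC i (ltnW ltin); have [CS simp] := simple i ltin.
rewrite exprSr -scalerA; apply: IH (ltnW ltin) _ _; apply: contrapT => nCsx.
have Csx := submZ s (sC _ ltin) Cx.
have /= [||eqL|eqL] := simp (addspan (C i) (s *: x)) (addspan_submodule _ sCi).
- exact: addspan_sub.
- by apply: addspan_min => //; [exact: sC|case: CS].
- by apply: nCsx; rewrite -eqL; apply: addspan_mem.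
(* Nakayama: [x = c + (r * s) *: x] with [1 - r * s] a unit forces [x] into [C i]. *)
- have : addspan (C i) (s *: x) x by rewrite eqL.
  case=> c Cc [r xE].
  have [u uE] : exists u, u * (1 - r * s) = 1.
    by apply: local_unit1B; apply: idealM => //; apply: local_submodule.
  apply: nCsx; apply: submZ => //; rewrite -[x]scale1r -uE -scalerA.
  apply: submZ => //; suff -> : (1 - r * s) *: x = c by [].
  by rewrite scalerBl scale1r -scalerA {1}xE addrK.
Qed.

End Local.

(** * The residue field at a prime, as the fraction field of the quotient *)

Section ResidueField.
Variables (R : comNzRingType) (P : set R) (pP : prime_ideal P).

Definition prime_quot : Type := {ideal_quot (ideal_pred (proj1 pP) : idealr R)}.
HB.instance Definition _ := GRing.ComNzRing.on prime_quot.

Definition to_quot (x : R) : prime_quot :=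
  \pi_({ideal_quot (ideal_pred (proj1 pP) : idealr R)})%qT x.

Fact to_quot_zmod_morphism : zmod_morphism to_quot.
Proof. by move=> x y; rewrite /to_quot rmorphB. Qed.
Fact to_quot_monoid_morphism : monoid_morphism to_quot.
Proof. by split=> [|x y]; rewrite /to_quot ?rmorph1 ?rmorphM. Qed.
HB.instance Definition _ := GRing.isZmodMorphism.Build R prime_quot to_quot to_quot_zmod_morphism.
HB.instance Definition _ := GRing.isMonoidMorphism.Build R prime_quot to_quot to_quot_monoid_morphism.

Lemma to_quot_eq0 x : to_quot x = 0 <-> P x.
Proof.
have -> : (to_quot x = 0) <-> (to_quot x = to_quot 0) by rewrite rmorph0.
rewrite /to_quot; split.
  by move=> /eqP; rewrite -Quotient.idealrBE subr0 => /set_mem.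
by move=> Px; apply/eqP; rewrite -Quotient.idealrBE subr0; apply/mem_set.
Qed.

Lemma to_quot_surj y : exists x, to_quot x = y.
Proof. by exists (repr y); rewrite /to_quot reprK. Qed.

(** Integral domains are built over rings with a unit predicate, so inverses are picked by choice;
    non-units are sent to themselves, as the interface demands. *)
Definition prime_quot_unit : pred prime_quot := fun x => `[< exists y, y * x = 1 >].
Definition prime_quot_inv (x : prime_quot) : prime_quot :=
  if pselect (exists y, y * x = 1) is left h then projT1 (cid h) else x.

Fact prime_quot_mulVx : {in prime_quot_unit, left_inverse 1 prime_quot_inv *%R}.
Proof.
move=> x /asboolP ux; rewrite /prime_quot_inv; case: pselect => // h.
exact: (projT2 (cid h)).
Qed.
Fact prime_quot_unitPl x y : y * x = 1 -> prime_quot_unit x.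
Proof. by move=> yx; apply/asboolP; exists y. Qed.
Fact prime_quot_inv_out : {in [predC prime_quot_unit], prime_quot_inv =1 id}.
Proof.
move=> x /asboolP nux; rewrite /prime_quot_inv; by case: pselect.
Qed.
HB.instance Definition _ := GRing.ComNzRing_hasMulInverse.Build prime_quot
  prime_quot_mulVx prime_quot_unitPl prime_quot_inv_out.

Fact prime_quot_integral : GRing.integral_domain_axiom prime_quot.
Proof.
move=> x y; have [a <-] := to_quot_surj x; have [b <-] := to_quot_surj y.
rewrite -rmorphM => /to_quot_eq0; have /primeP[_ _ Pp] := pP.
by case/Pp => /to_quot_eq0 ->; rewrite eqxx ?orbT.
Qed.
HB.instance Definition _ := GRing.ComUnitRing_isIntegral.Build prime_quot prime_quot_integral.

Lemma residue_field : exists (K : fieldType) (f : {rmorphism R -> K}),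
  forall x, f x = 0 <-> P x.
Proof.
exists {fraction prime_quot}, (@tofrac prime_quot \o to_quot : {rmorphism R -> _}) => x.
rewrite -to_quot_eq0 /=; split=> [/eqP|->]; last by rewrite rmorph0.
by rewrite tofrac_eq0 => /eqP.
Qed.

End ResidueField.

(** * Dimension and minimal primes *)

Section Dimension.
Variable R : comNzRingType.

(** The lengths of prime chains of [R / I], read in [R]; this makes different ideals comparable
    without their quotient rings. *)
Definition chains_over (I : set R) : set nat :=
  [set n | exists P, prime_chain n P /\ I `<=` P 0%N].

Lemma prime_chain_sub (S : comNzRingType) n (P : nat -> set S) i :
  prime_chain n P -> (i <= n)%N -> P 0%N `<=` P i.
Proof.
move=> [_ lt]; elim: i => [|i IH ltin]; first by move=> _ x.
apply: subset_trans (IH (ltnW ltin)) _.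
by case: (lt i ltin).
Qed.

Section Quotient.
Variables (Q : comNzRingType) (f : {rmorphism R -> Q}) (I : set R).
Hypotheses (f_surj : forall y, exists x, f x = y) (f_ker : forall x, f x = 0 <-> I x).

Lemma prime_preimage (P : set Q) : prime_ideal P -> prime_ideal (f @^-1` P).
Proof.
move=> /primeP[/submoduleP[P0 Pl] P1 Pp]; apply/primeP; split.
- apply/submoduleP; split; rewrite /preimage /= ?rmorph0 // => a u v Pu Pv.
  by rewrite rmorphD rmorphM; apply: Pl.
- by rewrite /preimage /= rmorph1.
- by move=> a b; rewrite /preimage /= rmorphM; apply: Pp.
Qed.

Lemma image_primeE (P : set R) x : prime_ideal P -> I `<=` P -> (f @` P) (f x) <-> P x.
Proof.
move=> /primeP[sP _ _] IP; split=> [[y Py fyx]|Px]; last by exists x.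
rewrite -[x](subrK y); apply: (@submD _ R^o) => //; apply/IP/f_ker.
by rewrite rmorphB fyx subrr.
Qed.

Lemma prime_image (P : set R) : prime_ideal P -> I `<=` P -> prime_ideal (f @` P).
Proof.
move=> pP IP; have E x := image_primeE x pP IP; have /primeP[sP P1 Pp] := pP.
apply/primeP; split.
- apply/submoduleP; split; first by exists 0; [exact: sub0m sP|rewrite rmorph0].
  move=> a _ _ [u Pu <-] [v Pv <-]; have [b <-] := f_surj a.
  exists (b * u + v); last by rewrite rmorphD rmorphM.
  by apply: (@submD _ R^o) => //; apply: idealM.
- by rewrite -(rmorph1 f) E.
- move=> a b; have [c <-] := f_surj a; have [d <-] := f_surj b.
  by rewrite -rmorphM !E; apply: Pp.
Qed.

Lemma chains_quot n :
  (exists P : nat -> set Q, prime_chain n P) <-> chains_over I n.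
Proof.
split=> [[P [pP ltP]]|[P [chP IP]]].
  exists (fun i => f @^-1` P i); split; last first.
    by move=> x /f_ker fx; rewrite /preimage /= fx; have /primeP[/sub0m] := pP 0%N (leq0n _).
  split=> i lein; first exact/prime_preimage/pP.
  have [sub nsub] := ltP i lein; split=> [x|sub']; first exact: sub.
  by apply: nsub => y; have [x <-] := f_surj y; apply: sub'.
have IPi i : (i <= n)%N -> I `<=` P i.
  by move=> lein; apply: subset_trans IP _; apply: prime_chain_sub lein.
have [pP ltP] := chP.
exists (fun i => f @` P i); split=> i lein.
  by apply: prime_image; [apply: pP|apply: IPi].
have [sub nsub] := ltP i lein; split=> [|sub']; first exact: image_subset.
apply: nsub => x Px; have pPi := pP i (ltnW lein).
by apply/(image_primeE x pPi (IPi _ (ltnW lein))); apply: sub'; exists x.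
Qed.

End Quotient.

Lemma dim_quotE I : is_proper_ideal I ->
  dim_quot I = supremum (-1)%:E [set n%:Z%:E | n in chains_over I].
Proof.
rewrite /dim_quot => pI; case: pselect => // hI; rewrite /krull_dim; congr supremum.
pose Q : comNzRingType := {ideal_quot (ideal_pred hI : idealr R)}.
pose f : {rmorphism R -> Q} := \pi_Q%qT.
suff -> : chains_over I = [set n : nat | exists P : nat -> set Q, prime_chain n P] by [].
have f_surj y : exists x, f x = y by exists (repr y); rewrite /f /= reprK.
have f_ker x : f x = 0 <-> I x.
  have -> : (f x = 0) <-> (f x = f 0) by rewrite rmorph0.
  split; first by move=> /eqP; rewrite /f /= -Quotient.idealrBE subr0 => /set_mem.
  by move=> Ix; apply/eqP; rewrite /f /= -Quotient.idealrBE subr0; apply/mem_set.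
by apply/seteqP; split=> n /(chains_quot f_surj f_ker).
Qed.

Lemma chains_over_down I n k : (k <= n)%N -> chains_over I n -> chains_over I k.
Proof.
move=> lekn [P [[pP ltP] IP]]; exists P; split=> //; split=> i lei.
  by apply: pP; apply: leq_trans lekn.
by apply: ltP; apply: leq_trans lekn.
Qed.

Lemma chains_over_total I J :
  chains_over I `<=` chains_over J \/ chains_over J `<=` chains_over I.
Proof.
have [|/existsNP[n /not_implyP[In nJn]]] := pselect (chains_over I `<=` chains_over J).
  by left.
right=> k Jk; apply: chains_over_down In; rewrite leqNgt; apply/negP => /ltnW ltnk.
by apply/nJn/chains_over_down/Jk.
Qed.

Lemma chains_over_sub I J : I `<=` J -> chains_over J `<=` chains_over I.
Proof. by move=> IJ n [P [chP JP]]; exists P; split=> //; apply: subset_trans JP. Qed.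

Hypothesis noethR : noetherian_ring R.

(** A prime containing [a * b] from [I] contains [I + (a)] or [I + (b)], so the lists for these two
    larger ideals can be concatenated. For [I = 0] the list includes all minimal primes. *)
Lemma finite_primes_under : forall I : set R^o, submodule I ->
  exists ps : seq (set R), (forall p, p \in ps -> prime_ideal p) /\
    forall q : set R, prime_ideal q -> I `<=` q -> exists2 p, p \in ps & p `<=` q.
Proof.
apply: noetherian_ind => // I sI IH.
have [pI|npI] := pselect (prime_ideal (I : set R)).
  exists [:: I : set R]; split=> [p|q pq Iq]; first by rewrite inE => /eqP ->.
  by exists I; rewrite ?inE.
have [I1|nI1] := pselect (I 1).
  exists [::]; split=> // q /primeP[_ q1 _] Iq; by case: q1; apply: Iq.
have /existsNP[a /existsNP[b]] : ~ forall a b, I (a * b) -> I a \/ I b.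
  by move=> Ip; apply: npI; apply/primeP; split.
move=> /not_implyP[Iab /not_orP[nIa nIb]].
have ext (x : R^o) : ~ I x -> exists ps : seq (set R), (forall p, p \in ps -> prime_ideal p) /\
    forall q : set R, prime_ideal q -> addspan I x `<=` q -> exists2 p, p \in ps & p `<=` q.
  move=> nIx; apply: IH; first exact: addspan_submodule.
  split; first exact: addspan_sub.
  by move=> sub; apply/nIx/sub/addspan_mem.
have [psa [pra ua]] := ext _ nIa; have [psb [prb ub]] := ext _ nIb.
exists (psa ++ psb); split=> [p|q pq Iq].
  by rewrite mem_cat => /orP[/pra|/prb].
have /primeP[sq _ /(_ _ _ (Iq _ Iab))] := pq; case=> qx.
  have [|p pin pq'] := ua _ pq; first exact: addspan_min.
  by exists p => //; rewrite mem_cat pin.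
have [|p pin pq'] := ub _ pq; first exact: addspan_min.
by exists p => //; rewrite mem_cat pin orbT.
Qed.

(** Descent inside the finite list [ps]: below a listed prime [p] that is not minimal there is a
    smaller listed [p'], and fewer listed primes lie below [p']. *)
Lemma minimal_prime_under (q : set R) : prime_ideal q ->
  exists2 p : set R, minimal_prime p & p `<=` q.
Proof.
move=> pq; have [ps [prps under]] := finite_primes_under (submodule0 R^o).
have zsub (p : set R) : prime_ideal p -> [set 0] `<=` p.
  by move=> /primeP[/sub0m p0 _ _] _ ->.
pose cnt (p : set R) := count (fun p' => `[< p' `<=` p >]) ps.
suff from_ps p : p \in ps -> exists2 p0 : set R, minimal_prime p0 & p0 `<=` p.
  have [p pin pq'] := under _ pq (zsub _ pq).
  have [p0 mp0 p0p] := from_ps p pin.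
  by exists p0 => //; apply: subset_trans pq'.
have [n] := ubnP (cnt p); elim: n p => // n IH p ltn pin; have pp := prps _ pin.
have [mp|] := pselect (minimal_prime p); first by exists p => // x.
move=> /not_andP[//|/existsNP[q' /not_implyP[pq' /not_implyP[q'p neq]]]].
have [p' p'in p'q'] := under _ pq' (zsub _ pq').
have p'p : p' `<=` p by apply: subset_trans q'p.
have [|p0 mp0 p0p] := IH p' _ p'in; last first.
- by exists p0 => //; apply: subset_trans p'p.
apply: leq_trans (ltn : (_ <= n)%N); rewrite /cnt.
have -> : count (fun p'' => `[< p'' `<=` p >]) ps =
    (count (fun p'' => `[< p'' `<=` p' >]) ps +
     count (fun p'' => `[< p'' `<=` p >] && ~~ `[< p'' `<=` p' >]) ps)%N.
  rewrite -count_predUI [X in (_ + X)%N](_ : _ = 0%N); last first.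
    by apply/eqP; rewrite -leqn0 leqNgt -has_count; apply/hasPn => x _ /=;
      case: asboolP => //=; rewrite andbF.
  rewrite addn0; apply: eq_count => x /=; case: (asboolP (x `<=` p')) => /= [xp'|_].
    by apply/asboolP; apply: subset_trans p'p.
  by rewrite andbT.
(* [p] itself is counted below [p] but not below [p']. *)
rewrite -addn1 leq_add2l -has_count; apply/hasP; exists p => //.
apply/andP; split; first by apply/asboolP => x.
apply/asboolP => pp'; apply: neq; apply/seteqP; split=> //.
exact: subset_trans p'q'.
Qed.

(* The sets [chains_over p] are initial segments of nat, hence linearly ordered;
   comparing them avoids any finiteness of the dimension. *)
Lemma dim_quot_minimal_prime (I : set R) : is_proper_ideal I ->
  (forall p : set R, minimal_prime p -> I `<=` p) ->
  exists p : set R, minimal_prime p /\ dim_quot I = dim_quot p.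
Proof.
move=> pI Imin; have /idealP[sI I1] := pI.
have [ps [prps under]] := finite_primes_under (submodule0 R^o).
have zsub (p : set R) : prime_ideal p -> [set 0] `<=` p.
  by move=> /primeP[/sub0m p0 _ _] _ ->.
have [q pq Iq] : exists2 q : set R, prime_ideal q & I `<=` q.
  have [n|q [pq Iq _]] := prime_avoiding noethR sI (s := 1); last by exists q.
  by rewrite expr1n.
have [p0 p0in _] := under _ pq (zsub _ pq).
have [p pin pmax] : exists2 p, p \in ps & forall p', p' \in ps ->
    chains_over p' `<=` chains_over p.
  elim: ps p0 p0in {prps under} => // a ps IH p0 _.
  have [ps0|[b bin]] : ps = [::] \/ exists b, b \in ps.
  - by case: (ps) => [|b s]; [left|right; exists b; rewrite inE eqxx].
  - by exists a; rewrite ?ps0 ?inE // => p'; rewrite inE => /eqP -> x.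
  have [p pin pmax] := IH b bin.
  have [ap|pa] := chains_over_total a p.
    by exists p; rewrite ?inE ?pin ?orbT // => p' /predU1P[->|/pmax].
  exists a; rewrite ?inE ?eqxx // => p' /predU1P[-> //|/pmax p'p].
  exact: subset_trans pa.
have [p1 mp1 p1p] := minimal_prime_under (prps _ pin).
exists p1; split=> //; rewrite !dim_quotE //; last by case: mp1 => -[].
suff -> : chains_over I = chains_over p1 by [].
apply/seteqP; split; last by apply/chains_over_sub; apply: Imin.
(* A chain over [I] starts above some listed [p'], so it is a chain over [p'], and [p] admits every
   chain length that [p'] does. *)
move=> n [P [chP IP]]; have pP0 : prime_ideal (P 0%N) by apply: (proj1 chP).
have [p' p'in p'P] := under _ pP0 (zsub _ pP0).
apply: (chains_over_sub p1p); apply: (pmax p') => //.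
by exists P.
Qed.

Lemma exists_prime_neq (m : set R) : (0 < krull_dim R)%E ->
  exists2 p : set R, prime_ideal p & p <> m.
Proof.
move=> dim_gt0; apply: contrapT => none.
have all_m p : prime_ideal p -> p = m.
  by move=> pp; apply: contrapT => pm; apply: none; exists p.
suff S0 n : (exists P : nat -> set R, prime_chain n P) -> n = 0%N.
  move: dim_gt0; rewrite /krull_dim.
  (* The set of chain lengths is empty, with the default supremum -1, or consists of 0 alone. *)
  set S := (X in supremum _ X).
  have [->|] := pselect (S = set0); first by rewrite supremum0.
  move=> /eqP/set0P[x Sx].
  have -> : S = [set 0%:E].
    apply/seteqP; split=> [_ [k /S0 -> <-] //|_ ->].
    by case: Sx => k Hk _; exists 0%N => //; have k0 := S0 k Hk; rewrite k0 in Hk.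
  by rewrite supremum1.
case: n => // n [P [pP ltP]]; have [_ nsub] := ltP 0%N isT.
case: nsub; have -> : P 0%N = P 1%N by rewrite [LHS]all_m ?[RHS]all_m //; apply: pP.
by move=> x.
Qed.

End Dimension.

(** * Lengths as lengths of chains of submodules *)

Section Chains.
Variable R : comNzRingType.

(** Chains are strict but need not be saturated. Bounding them expresses that [B / A] has finite
    length without forming the quotient or a composition series. *)
Inductive chain (V : lmodType R) (A : set V) : set V -> nat -> Prop :=
| chain_nil : submodule A -> chain A A 0
| chain_cons B C n : chain A B n -> submodule C -> B `<` C -> chain A C n.+1.

Definition bounded_length (V : lmodType R) (A B : set V) : Prop :=
  exists b, forall n, chain A B n -> (n <= b)%N.

Section OneModule.
Variable V : lmodType R.
Implicit Types (A B C N : set V).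

Lemma chain_submodule A B n : chain A B n -> submodule A /\ submodule B.
Proof. by elim=> // {}B C k _ [sA _] sC _; split. Qed.

Lemma chain_subset A B n : chain A B n -> A `<=` B.
Proof. by elim=> [_ x //|{}B C k _ AB _ [BC _]]; apply: subset_trans BC. Qed.

Lemma properP A B : A `<` B <-> A `<=` B /\ A <> B.
Proof.
split=> -[AB]; first by move=> nBA; split=> // E; apply: nBA; rewrite E.
by move=> neq; split=> // BA; apply: neq; apply/seteqP.
Qed.

Lemma chain_snoc A B C n : chain A B n -> submodule C -> B `<=` C ->
  exists2 k, (n <= k)%N & chain A C k.
Proof.
move=> ch sC BC; have [E|neq] := pselect (B = C); first by exists n => //; rewrite -E.
by exists n.+1 => //; apply: chain_cons ch sC _; apply/properP.
Qed.

Lemma chain_exists A B : submodule A -> submodule B -> A `<=` B -> exists n, chain A B n.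
Proof.
by move=> sA sB AB; have [k _] := chain_snoc (chain_nil sA) sB AB; exists k.
Qed.

Lemma chain_cat A B C n k : chain A B n -> chain B C k -> chain A C (n + k).
Proof.
move=> chAB; elim=> [_|D E j _ IH sE DE]; first by rewrite addn0.
by rewrite addnS; apply: chain_cons IH sE DE.
Qed.

Definition subm_add A B : set V := [set v | exists a b, [/\ A a, B b & v = a + b]].

Lemma subm_add_submodule A B : submodule A -> submodule B -> submodule (subm_add A B).
Proof.
move=> sA sB; apply/submoduleP; split.
  by exists 0, 0; rewrite addr0; split=> //; apply: sub0m.
move=> r _ _ [a [b [Aa Bb ->]]] [c [d [Ac Bd ->]]].
exists (r *: a + c), (r *: b + d); split; last by rewrite scalerDr addrACA.
  by apply: submD => //; apply: submZ.
by apply: submD => //; apply: submZ.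
Qed.

Lemma subm_addl A B : submodule B -> A `<=` subm_add A B.
Proof. by move=> /sub0m B0 a Aa; exists a, 0; rewrite addr0. Qed.

Lemma subm_addr A B : submodule A -> B `<=` subm_add A B.
Proof. by move=> /sub0m A0 a Aa; exists 0, a; rewrite add0r. Qed.

Lemma submoduleI A B : submodule A -> submodule B -> submodule (A `&` B).
Proof.
move=> /submoduleP[A0 Al] /submoduleP[B0 Bl]; apply/submoduleP; split=> //.
by move=> r u v [Au Bu] [Av Bv]; split; [apply: Al|apply: Bl].
Qed.

(** The modular law: if sums and intersections both agreed, writing [y = x + b] would put [b] in [Y]
    and [B], hence in [X], and so [y] in [X]. *)
Lemma modular_proper B X Y : submodule B -> submodule X -> submodule Y -> X `<` Y ->
  X `&` B <> Y `&` B \/ subm_add X B <> subm_add Y B.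
Proof.
move=> sB sX sY [XY nYX]; apply: contrapT => /not_orP[/contrapT EI /contrapT EA].
apply: nYX => y Yy.
have : subm_add Y B y by apply: subm_addl.
rewrite -EA => -[x [b [Xx Bb yE]]].
have : (Y `&` B) b.
  split=> //; have -> : b = y - x by rewrite yE addrC addKr.
  by apply: submB => //; apply: XY.
by rewrite -EI => -[Xb _]; rewrite yE; apply: submD.
Qed.

(** Intersecting with [B] gives a chain below [B], adding [B] gives one above it, and each strict
    step survives in at least one of them. This is one half of the additivity of length. *)
Lemma chain_split A B C n : chain A C n -> submodule B -> A `<=` B -> B `<=` C ->
  exists n1 n2, [/\ (n <= n1 + n2)%N, chain A B n1 & chain B C n2].
Proof.
move=> ch sB AB BC.
suff [n1 [n2 [le ch1 ch2]]] : exists n1 n2, [/\ (n <= n1 + n2)%N,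
    chain A (C `&` B) n1 & chain B (subm_add C B) n2].
  exists n1, n2; split=> //; first by move: ch1; rewrite setIidr.
  have E : subm_add C B = C; last by rewrite E in ch2.
  have [_ sC] := chain_submodule ch.
  apply/seteqP; split; last exact: subm_addl.
  by move=> _ [c [b [Cc /BC Cb ->]]]; apply: submD.
elim: ch {BC} => {C n} [sA|X Y n ch [n1 [n2 [le ch1 ch2]]] sY XY].
  exists 0%N, 0%N; rewrite setIidl //; split=> //; first exact: chain_nil.
  have -> : subm_add A B = B; last exact: chain_nil.
  apply/seteqP; split; last exact: subm_addr.
  by move=> _ [a [b [/AB Ba Bb ->]]]; apply: submD.
have [_ sX] := chain_submodule ch.
have subI : X `&` B `<=` Y `&` B by case: XY => XY _ x [/XY].
have subA : subm_add X B `<=` subm_add Y B.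
  by case: XY => XY _ _ [a [b [/XY Ya Bb ->]]]; exists a, b.
have sI := submoduleI sY sB; have sA := subm_add_submodule sY sB.
case: (modular_proper sB sX sY XY) => neq.
- have [k lek ch2'] := chain_snoc ch2 sA subA.
  exists n1.+1, k; split=> //; first by rewrite addSn ltnS; apply: leq_trans le _; rewrite leq_add2l.
  by apply: chain_cons ch1 sI _; apply/properP.
- have [k lek ch1'] := chain_snoc ch1 sI subI.
  exists k, n2.+1; split=> //; first by rewrite addnS ltnS; apply: leq_trans le _; rewrite leq_add2r.
  by apply: chain_cons ch2 sA _; apply/properP.
Qed.

Lemma bounded_length_trans A B C : submodule B -> A `<=` B -> B `<=` C ->
  bounded_length A B -> bounded_length B C -> bounded_length A C.
Proof.
move=> sB AB BC [b1 H1] [b2 H2]; exists (b1 + b2)%N => n ch.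
have [n1 [n2 [le /H1 le1 /H2 le2]]] := chain_split ch sB AB BC.
by apply: leq_trans le _; apply: leq_add.
Qed.

Lemma bounded_length_sub A B C : submodule C -> B `<=` C ->
  bounded_length A C -> bounded_length A B.
Proof.
move=> sC BC [b H]; exists b => n ch; have [k lek /H] := chain_snoc ch sC BC.
exact: leq_trans.
Qed.

Lemma bounded_length_refl A : bounded_length A A.
Proof.
exists 0%N => n ch; case: {-1}A n / ch (erefl A) => // B C n ch _ [_ nCB] AC.
by case: nCB; rewrite -AC; apply: chain_subset ch.
Qed.

Lemma bounded_length_super A B C n : chain A B n -> bounded_length A C -> bounded_length B C.
Proof.
move=> ch [b H]; exists b => k /(chain_cat ch) /H; apply: leq_trans.
exact: leq_addl.
Qed.

Definition span_over A (xs : seq V) : set V := foldl (@addspan R V) A xs.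

Lemma span_over_submodule A xs : submodule A -> submodule (span_over A xs).
Proof. by elim: xs A => //= x xs IH A sA; apply/IH/addspan_submodule. Qed.

Lemma span_over_sub A xs : A `<=` span_over A xs.
Proof.
elim: xs A => [|x xs IH] A //=; apply: subset_trans (IH _); exact: addspan_sub.
Qed.

Lemma span_over_mem A xs x : submodule A -> x \in xs -> span_over A xs x.
Proof.
elim: xs A => //= y xs IH A sA; rewrite inE => /predU1P[->|]; last exact/IH/addspan_submodule.
by apply: span_over_sub; apply: addspan_mem.
Qed.

Lemma bounded_length_span A xs : submodule A ->
  (forall A' x, submodule A' -> A `<=` A' -> x \in xs -> bounded_length A' (addspan A' x)) ->
  bounded_length A (span_over A xs).
Proof.
elim: xs A => [|x xs IH] A sA H /=; first exact: bounded_length_refl.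
have sA' := addspan_submodule x sA.
apply: (bounded_length_trans sA'); [exact: addspan_sub|exact: span_over_sub| |].
  by apply: H => //; rewrite inE eqxx.
apply: IH => // A'' y sA'' sub yin; apply: H => //; last by rewrite inE yin orbT.
by apply: subset_trans sub; apply: addspan_sub.
Qed.

End OneModule.

(** Strict monotonicity is asked only between [A] and [B], so that [g] may be an image, a preimage
    or a sum with a fixed submodule. *)
Lemma chain_map (V W : lmodType R) (A B : set V) (n : nat) (g : set V -> set W) :
  (forall X, submodule X -> A `<=` X -> X `<=` B -> submodule (g X)) ->
  (forall X Y, submodule X -> submodule Y -> A `<=` X -> X `<` Y -> Y `<=` B -> g X `<` g Y) ->
  chain A B n -> chain (g A) (g B) n.
Proof.
move=> gs gp ch; elim: ch gs gp => {B n} [sA|X Y n ch IH sY XY] gs gp.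
  by apply: chain_nil; apply: gs.
have [sA sX] := chain_submodule ch; have AX := chain_subset ch; have [XY' _] := XY.
apply: chain_cons (gp _ _ _ _ AX XY _) => //; last first.
  by apply: gs => //; apply: subset_trans XY'.
apply: IH => [Z sZ AZ ZX|Z Z' sZ sZ' AZ ZZ' Z'X].
  by apply: gs => //; apply: subset_trans XY'.
by apply: gp => //; apply: subset_trans XY'.
Qed.

End Chains.

(** The local cohomology $H^0_m(V)$: when [m] is finitely generated, exponents depending on [s] give
    the same elements as a power of [m]. *)
Definition torsion_part (R : comNzRingType) (m : set R) (V : lmodType R) : set V :=
  [set v | forall s, m s -> exists k, s ^+ k *: v = 0].
Arguments torsion_part {R} m V _.

(** * Finite length of modules generated by torsion elements *)

Section Torsion.
Variables (R : comNzRingType) (m : set R).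
Hypotheses (noethR : noetherian_ring R) (localR : local_ring m).

Lemma chain_uncons (V : lmodType R) (A C : set V) n : chain A C n.+1 ->
  exists B, [/\ chain A B n, submodule C & B `<` C].
Proof.
move=> ch; case: {-2}_ {-2}_ / ch (erefl C) (erefl n.+1) => // B {}C k ch sC BC _ [kn].
by exists B; split=> //; rewrite -kn.
Qed.

(** If [a + r *: x] is outside [A], then [r] is a unit, so every submodule over [A] containing that
    element contains [x]. *)
Lemma bounded_length_simple (V : lmodType R) (A : set V) x : submodule A ->
  (forall s, m s -> A (s *: x)) -> bounded_length A (addspan A x).
Proof.
move=> sA Amx; exists 1%N => -[|[|n]] // /chain_uncons[B [ch _ [Bsub nsub]]].
have [B' [ch' sB [B'B nBB']]] := chain_uncons ch.
have AB' := chain_subset ch'.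
have AB : A `<=` B := subset_trans AB' B'B.
have /existsNP[v /not_implyP[Bv nAv]] : ~ B `<=` A.
  by move=> BA; apply: nBB'; apply: subset_trans AB'.
case: nsub; apply: addspan_min => //.
have [a Aa [r vE]] := Bsub v Bv.
have [|/(local_unit noethR localR)[u ur]] := pselect (m r).
  by move=> /Amx Arx; case: nAv; rewrite vE; apply: submD.
have -> : x = u *: (v - a) by rewrite vE addrC addKr scalerA ur scale1r.
by apply: submZ => //; apply: submB => //; apply: AB.
Qed.

(** Induction on the sum of exponents [k i] with [y i ^+ k i *: x] in [A], for generators [y i] of
    [m]. The intermediate module is [B = A + m x]: each [y i *: x] has a smaller exponent sum, and
    [m] kills [x] modulo [B]. *)
Lemma bounded_length_addspan (V : lmodType R) (A : set V) x : submodule A ->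
  (forall s, m s -> exists k, A (s ^+ k *: x)) -> bounded_length A (addspan A x).
Proof.
move=> sA tors; have [t [y genm]] := noethR (local_submodule localR).
have my i : m (y i) by rewrite genm; apply: generator_mem.
have [k Hk] := choice (fun i => tors (y i) (my i)).
have [N] := ubnP (\sum_i k i)%N.
elim: N => // N IH in A x k sA {tors} Hk *; rewrite ltnS => leN.
have [Ax|nAx] := pselect (A x).
  have -> : addspan A x = A; last exact: bounded_length_refl.
  by apply/seteqP; split; [apply: addspan_min|apply: addspan_sub].
have k_gt0 i : (0 < k i)%N.
  by rewrite lt0n; apply/eqP => ki; apply: nAx; have := Hk i; rewrite ki scale1r.
pose B := span_over A [seq (y i : R) *: x | i <- enum 'I_t].
have sB : submodule B by apply: span_over_submodule.
have AB : A `<=` B by apply: span_over_sub.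
have sBx := addspan_submodule x sB.
apply: (@bounded_length_sub _ _ _ _ (addspan B x)) => //.
  apply: addspan_min => //; last exact: addspan_mem.
  exact: subset_trans (@addspan_sub _ _ B x).
apply: (bounded_length_trans sB) => //; first exact: addspan_sub.
  apply: bounded_length_span => // A' _ sA' AA' /mapP[i _ ->].
  apply: (IH A' _ (fun j => if j == i then (k i).-1 else k j)) => //.
    move=> j; apply: AA'; case: eqP => [->|_].
      by rewrite scalerA -exprSr prednK.
    by rewrite scalerA mulrC -scalerA; apply: submZ.
  apply: leq_trans leN; rewrite [ltnRHS](bigD1 i) //= (bigD1 i) //= eqxx.
  rewrite -addSn prednK // leq_add2l; apply: leq_sum => j /negPf -> //.
apply: bounded_length_simple => // s; rewrite genm => -[c _ <-].
rewrite scaler_suml; apply: subm_sum => // i _; rewrite -scalerA.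
apply: submZ => //; apply: span_over_mem => //.
by apply/mapP; exists i; rewrite ?mem_enum.
Qed.

Lemma bounded_length_fg (V : lmodType R) (T : finType) (g : T -> V) (B : set V) :
  submodule B -> (forall t s, m s -> exists k, s ^+ k *: g t = 0) ->
  (forall v, B v -> exists c : T -> R, v = \sum_t c t *: g t) ->
  bounded_length [set 0] B.
Proof.
move=> sB tors gen; have s0 := submodule0 V.
pose C := span_over [set 0] [seq g t | t <- enum T].
have sC : submodule C by apply: span_over_submodule.
apply: (bounded_length_sub sC).
  move=> _ /gen[c ->]; apply: subm_sum => // t _; apply: submZ => //.
  by apply: span_over_mem => //; apply: map_f; rewrite mem_enum.
apply: bounded_length_span => // A' _ sA' A'0 /mapP[t _ ->].
apply: bounded_length_addspan => // s /(tors t)[k E].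
by exists k; rewrite E; apply: sub0m.
Qed.

Lemma torsion_part_submodule (V : lmodType R) : submodule (torsion_part m V).
Proof.
apply/submoduleP; split=> [s _|a u v Tu Tv s ms]; first by exists 0%N; rewrite scaler0.
have [k Ek] := Tu s ms; have [l El] := Tv s ms; exists (k + l)%N.
rewrite scalerDr exprD -[X in _ + X]scalerA El scaler0 addr0.
by rewrite scalerA -mulrA mulrC -scalerA Ek scaler0.
Qed.

Lemma torsion_part_linear (V W : lmodType R) (f : {linear V -> W}) v :
  torsion_part m V v -> torsion_part m W (f v).
Proof. by move=> Tv s /Tv[k E]; exists k; rewrite -linearZ E linear0. Qed.

(** Torsion vectors have torsion coordinates, so generators of the torsion ideal of [R] times basis
    vectors generate; only ideals have to be finitely generated. *)
Lemma torsion_part_bounded n : bounded_length [set 0] (torsion_part m 'rV[R]_n).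
Proof.
have [l [g genT]] := noethR (torsion_part_submodule R^o).
have Tg i : torsion_part m R^o (g i) by rewrite genT; apply: generator_mem.
apply: (@bounded_length_fg _ ('I_n * 'I_l)%type (fun p => (g p.2 : R) *: delta_mx 0 p.1)).
- exact: torsion_part_submodule.
- move=> [i j] s /(Tg j)[k E]; exists k.
  by rewrite scalerA [_ * _]E scale0r.
move=> v Tv; have Tc i : torsion_part m R^o (v 0 i : R^o).
  by move=> s /Tv[k /rowP/(_ i)]; rewrite !mxE => E; exists k.
have Ec i : exists c : 'I_l -> R, v 0 i = \sum_j c j * g j.
  by have := Tc i; rewrite genT => -[c _ <-]; exists c.
have [c Hc] := choice Ec; exists (fun p => c p.1 p.2).
rewrite -(pair_bigA _ (fun i j => c i j *: (g j *: delta_mx 0 i))) /=.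
rewrite {1}[v]row_sum_delta; apply: eq_bigr => i _; rewrite Hc scaler_suml.
by apply: eq_bigr => j _; rewrite scalerA.
Qed.

End Torsion.

Lemma image_submodule (R : comNzRingType) (V W : lmodType R) (h : {linear V -> W})
    (X : set V) :
  submodule X -> submodule (h @` X).
Proof.
move=> sX; apply/submoduleP; split; first by exists 0; [exact: sub0m|rewrite linear0].
move=> r _ _ [x Xx <-] [y Yy <-]; exists (r *: x + y); last by rewrite linearP.
by apply: submD => //; apply: submZ.
Qed.

(** * Kernel against cokernel of an endomorphism *)

Section Descent.
Variables (R : comNzRingType) (V : lmodType R) (f : {linear V -> V}) (T : set V).
Hypotheses (sT : submodule T) (bT : bounded_length [set 0] T).
Hypotheses (fT : forall v, T v -> T (f v)) (Tf : forall v, T (f v) -> T v).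
Let K : set V := [set v | f v = 0].
Hypothesis ndense : subm_add (range f) T <> [set: V].

(** Let [t] be the maximal length of a chain from [K] to [T]. A chain of length [n + t] through [K]
    is split at the image of [T]: the lower part pulls back to a chain from [K] to [T], so it has at
    most [t] steps, and the upper part, of at least [n] steps, is moved above [range f]. *)
Lemma kernel_coker_chain n : chain [set 0] K n ->
  exists2 k, (n < k)%N & chain (range f) [set: V] k.
Proof.
move=> chK; have s0 := submodule0 V.
have sK : submodule K by have [] := chain_submodule chK.
have KT : K `<=` T by move=> v Kv; apply: Tf; rewrite Kv; apply: sub0m.
have sfT : submodule (f @` T) by apply: image_submodule.
have fTT : f @` T `<=` T by move=> _ [v Tv <-]; apply: fT.
have sub0 (X : set V) : submodule X -> [set 0] `<=` X by move=> sX _ ->; apply: sub0m.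
have [b Hb] := bounded_length_super chK bT.
have [t cht tmax] : exists2 t, chain K T t & forall j, chain K T j -> (j <= t)%N.
  have ex : exists t, `[< chain K T t >].
    by have [t ch] := chain_exists sK sT KT; exists t; apply/asboolP.
  have ub j : `[< chain K T j >] -> (j <= b)%N by move=> /asboolP /Hb.
  by case: (ex_maxnP ex ub) => t /asboolP ch tmax; exists t => // j /asboolP /tmax.
have [n1 [n2 [le ch1 ch2]]] := chain_split (chain_cat chK cht) sfT (sub0 _ sfT) fTT.
have n1t : (n1 <= t)%N.
  apply: tmax; pose g X : set V := T `&` f @^-1` X.
  have -> : K = g [set 0] by apply/seteqP; split=> [v Kv|v []//]; split=> //; apply: KT.
  have -> : T = g (f @` T).
    by apply/seteqP; split=> [v Tv|v []//]; split=> //; exists v.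
  apply: chain_map ch1 => [X sX _ _|X Y sX sY _ [XY nYX] YfT].
    apply: submoduleI => //; apply/submoduleP; rewrite /preimage /=; split.
      by rewrite linear0; apply: sub0m.
    by move=> r u v Xu Xv; rewrite linearP; apply: submD => //; apply: submZ.
  split=> [v [Tv Xv]|sub]; first by split=> //; apply: XY.
  apply: nYX => y Yy; have [v Tv fv] := YfT y Yy.
  by have [_] := sub v (conj Tv (eq_ind_r Y Yy fv)); rewrite /preimage /= fv.
have n_n2 : (n <= n2)%N by rewrite -(leq_add2r t); apply: leq_trans le _; rewrite addnC leq_add2l.
have sF : submodule (range f) by apply: image_submodule; apply: submoduleT.
exists n2.+1; first by rewrite ltnS.
have -> : range f = subm_add (range f) (f @` T).
  apply/seteqP; split; first exact: subm_addl.
  by move=> _ [a [_ [Fa [v _ <-] ->]]]; apply: submD => //; exists v.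
(* The proper inclusion of [range f + T] in [V] supplies the extra step. *)
apply: (@chain_cons _ _ _ (subm_add (range f) T)); last first.
- by split=> // sub; apply: ndense; apply/seteqP.
- exact: submoduleT.
apply: chain_map ch2 => [X sX _ _|X Y sX sY fX [XY nYX] YT].
  exact: subm_add_submodule.
split=> [_ [a [x [Fa Xx ->]]]|sub]; first by exists a, x; split=> //; apply: XY.
(* Strictness survives because, by [Tf], [range f] meets [T] only in the image of [T]. *)
apply: nYX => y Yy; have [a [x [[w _ fw] Xx yE]]] := sub y (subm_addr sF Yy).
rewrite yE; apply: submD => //; apply: fX; exists w => //; apply: Tf.
rewrite fw; have -> : a = y - x by rewrite yE addrK.
by apply: submB => //; [apply: YT|apply: YT; apply: XY].
Qed.

End Descent.

(** * Ranks of the differentials *)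

Section Complex.
Variables (R : comNzRingType) (m : set R).
Hypotheses (noethR : noetherian_ring R) (localR : local_ring m).
Variables (beta : nat -> nat) (D : forall i, 'M[R]_(beta i.+1, beta i)).
Hypothesis D_exact : forall i (v : 'rV_(beta i.+1)),
  v *m D i = 0 <-> exists w, v = w *m D i.+1.
Hypothesis D_torsion : forall s, m s ->
  exists k, forall v : 'rV_(beta 0), exists w, s ^+ k *: v = w *m D 0.

(** Matrices act on row vectors from the right, so products appear in the reverse order of
    composition. *)
Lemma D_complex i : D i.+1 *m D i = 0.
Proof.
apply/row_matrixP => a; rewrite row_mul row0; apply/D_exact.
by exists (delta_mx 0 a); rewrite -rowE.
Qed.

Lemma D_lift i p (X : 'M_(p, beta i.+1)) : X *m D i = 0 -> exists Y, X = Y *m D i.+1.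
Proof.
move=> XD; have Ha a : exists w, row a X = w *m D i.+1.
  by apply/D_exact; rewrite -row_mul XD row0.
have [w Hw] := choice Ha; exists (\matrix_a w a).
by apply/row_matrixP => a; rewrite row_mul rowK Hw.
Qed.

(* Multiplication by [c] is null-homotopic. *)
Definition homotopy (c : R) : Prop :=
  (exists H, H *m D 0 = c%:M) /\
  forall i, exists H H', H' *m D i.+1 + D i *m H = c%:M.

Lemma homotopy_exists s : m s -> exists k, homotopy (s ^+ k).
Proof.
move=> /D_torsion[k Hk]; exists k; set c := s ^+ k in Hk *.
have H0 : exists H, H *m D 0 = c%:M.
  have [w Hw] := choice Hk; exists (\matrix_a w (row a 1%:M)).
  apply/row_matrixP => a; rewrite row_mul rowK -Hw.
  by apply/rowP => j; rewrite !mxE mulr_natr.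
split=> // i.
(* By this identity [D i] kills [c%:M - D i *m H], which therefore lifts through [D i.+1]; the lift
   is the next [H]. *)
suff [H HD] : exists H, D i *m H *m D i = c *: D i.
  have [|H' HE] := @D_lift i _ (c%:M - D i *m H).
    by rewrite mulmxBl HD mul_scalar_mx subrr.
  by exists H, H'; rewrite -HE subrK.
elim: i => [|i [H HD]].
  by have [H HE] := H0; exists H; rewrite -mulmxA HE mul_mx_scalar.
have [|H' HE] := @D_lift i _ (c%:M - D i *m H).
  by rewrite mulmxBl HD mul_scalar_mx subrr.
exists H'; rewrite -mulmxA -HE mulmxBr mul_mx_scalar mulmxA D_complex.
by rewrite mul0mx subr0.
Qed.

Lemma homotopy_sandwich c i : homotopy c -> exists H, D i *m H *m D i = c *: D i.
Proof.
case=> [[H0 E0] Hi]; case: i => [|i].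
  by exists H0; rewrite -mulmxA E0 mul_mx_scalar.
have [H [H' E]] := Hi i; exists H'.
rewrite -mulmxA (_ : H' *m D i.+1 = c%:M - D i *m H); last by rewrite -E addrK.
by rewrite mulmxBr mul_mx_scalar mulmxA D_complex mul0mx subr0.
Qed.

(* The subtraction is truncated; [alt_rankD] shows that it is exact as soon as
   R has a prime ideal other than m. *)
Fixpoint alt_rank i : nat :=
  if i is j.+1 then (beta j.+1 - alt_rank j)%N else beta 0.

Section Rank.
Variables (P : set R) (K : fieldType) (f : {rmorphism R -> K}).
Hypotheses (pP : prime_ideal P) (P_neq : P <> m) (f_ker : forall x, f x = 0 <-> P x).

Lemma homotopy_away : exists2 c, homotopy c & f c != 0.
Proof.
have [s ms nPs] := prime_neq_local noethR localR pP P_neq.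
have [k Hk] := homotopy_exists ms; exists (s ^+ k) => //.
by apply/eqP => /f_ker /(primeX pP).
Qed.

(** The zero composite gives one inequality. For the other, the homotopy writes a nonzero scalar
    matrix over [K] as a sum of two matrices factoring through the differentials. *)
Lemma rankDD i : (\rank (map_mx f (D i.+1)) + \rank (map_mx f (D i)))%N = beta i.+1.
Proof.
have [c [_ /(_ i)[H [H' E]]] fc] := homotopy_away.
have DD0 : map_mx f (D i.+1) *m map_mx f (D i) = 0.
  by rewrite -map_mxM D_complex map_mx0.
apply/eqP; rewrite eqn_leq; apply/andP; split.
  exact: mulmx0_rank_max DD0.
have := mxrank_add (map_mx f H' *m map_mx f (D i.+1)) (map_mx f (D i) *m map_mx f H).
rewrite -!map_mxM -map_mxD E map_scalar_mx -scalemx1 mxrank_scale_nz // mxrank1 !map_mxM.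
move/leq_trans; apply; apply: leq_add; [exact: mxrankM_maxr|exact: mxrankM_maxl].
Qed.

(** [H *m D 0 = c%:M] with [f c != 0] gives [D 0] full column rank; the recursion then fixes all
    ranks, whatever [P] is. *)
Lemma rankD i : \rank (map_mx f (D i)) = alt_rank i.
Proof.
elim: i => [|i IH] /=; last by have := rankDD i; rewrite IH => /(canRL (addnK _)).
have [c [[H E] _] fc] := homotopy_away.
apply/eqP; rewrite eqn_leq rank_leq_col /=.
have := mxrankM_maxr (map_mx f H) (map_mx f (D 0)).
by rewrite -map_mxM E map_scalar_mx -scalemx1 mxrank_scale_nz // mxrank1.
Qed.

End Rank.

Lemma alt_rankD i (P : set R) : prime_ideal P -> P <> m ->
  (alt_rank i.+1 + alt_rank i)%N = beta i.+1.
Proof.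
move=> pP Pm; have [K [f f_ker]] := residue_field pP.
by rewrite -!(rankD pP Pm f_ker) (rankDD pP Pm f_ker).
Qed.

Lemma alt_rank_gt0_ann i a (P : set R) : alt_rank i != 0%N -> a *: D i = 0 ->
  prime_ideal P -> P <> m -> P a.
Proof.
move=> ri aD pP Pm; have [K [f f_ker]] := residue_field pP.
apply/f_ker/eqP; apply: contraNT ri => fa; rewrite -(rankD pP Pm f_ker).
have /eqP : f a *: map_mx f (D i) = 0 by rewrite -map_mxZ aD map_mx0.
by rewrite scalemx_eq0 (negPf fa) => /eqP ->; rewrite mxrank0.
Qed.

(* Otherwise some prime P contains the annihilator of D_i but not s.  With
   D_i H D_i = c D_i, c a power of s, det (c - D_i H) annihilates D_i, while it is
   a power of c modulo P because D_i vanishes modulo P. *)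
Lemma alt_rank0_torsion i s : alt_rank i = 0%N -> m s -> exists k, s ^+ k *: D i = 0.
Proof.
move=> ri ms; apply: contrapT => /forallNP nk.
pose I : set R^o := [set a | (a : R) *: D i = 0].
have sI : submodule I.
  apply/submoduleP; split; first exact: scale0r.
  by move=> a u v Iu Iv; rewrite /I /= scalerDl -scalerA Iu Iv scaler0 addr0.
have [P [pP IP nPs]] := prime_avoiding noethR sI nk.
have Pm : P <> m by move=> E; apply: nPs; rewrite E.
have [K [f f_ker]] := residue_field pP.
have /eqP : \rank (map_mx f (D i)) = 0%N by rewrite (rankD pP Pm f_ker).
rewrite mxrank_eq0 => /eqP fD0.
have [k Hk] := homotopy_exists ms; have [H HD] := homotopy_sandwich i Hk.
set c := s ^+ k in Hk HD.
pose A := c%:M - D i *m H.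
have AD : A *m D i = 0 by rewrite mulmxBl HD mul_scalar_mx subrr.
have /IP /f_ker : I (\det A).
  by rewrite /I /= -mul_scalar_mx -mul_adj_mx -mulmxA AD mulmx0.
rewrite -det_map_mx map_mxB map_mxM fD0 mul0mx subr0 map_scalar_mx det_scalar.
move/eqP; rewrite expf_eq0 => /andP[_ /eqP /f_ker Pc].
by apply: nPs; apply: (primeX pP) Pc.
Qed.

End Complex.

(** Submodules containing the kernel are determined by their images, so strict inclusions above [A]
    survive. *)
Lemma chain_image (R : comNzRingType) (V W : lmodType R) (f : {linear V -> W})
    (A B : set V) n :
  (forall v, f v = 0 -> A v) -> chain A B n -> chain (f @` A) (f @` B) n.
Proof.
move=> kerA; apply: (@chain_map _ _ _ A B n (fun X => f @` X)) =>
  [X sX _ _|X Y sX sY AX [XY nYX] _].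
  exact: (image_submodule f).
split=> [_ [x Xx <-]|sub]; first by exists x => //; apply: XY.
apply: nYX => y Yy; have [x Xx fxy] := sub (f y) (ex_intro2 _ _ y Yy erefl).
rewrite -[y](subrK x); apply: submD => //; apply/AX/kerA.
by rewrite linearB fxy subrr.
Qed.

(** The sizes are linked by an equation because they will be two Betti numbers; once they are
    identified, the kernel and cokernel comparison applies with [T] the torsion of [R^n]. *)
Lemma square_matrix_chain (R : comNzRingType) (m P : set R) (n n' : nat)
    (A : 'M[R]_(n', n)) (k : nat) :
  noetherian_ring R -> local_ring m -> prime_ideal P -> P <> m ->
  n' = n -> (0 < n)%N -> (forall i j, m (A i j)) ->
  (forall v : 'rV_n', v *m A = 0 -> torsion_part m _ v) ->
  chain [set 0] [set v : 'rV_n' | v *m A = 0] k ->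
  exists2 l, (k < l)%N & chain (range (mulmxr A : 'rV_n' -> 'rV_n)) [set: 'rV_n] l.
Proof.
move=> noethR localR pP Pm E; rewrite {}E in A * => n_gt0 Am kerA chA.
have sm := local_submodule localR.
apply: (@kernel_coker_chain R _ (mulmxr A) (torsion_part m _)) chA.
- exact: torsion_part_submodule.
- exact: torsion_part_bounded.
- exact: torsion_part_linear.
- move=> v TvA s ms; have [j] := TvA s ms; rewrite -linearZ => /kerA /(_ s ms)[l].
  by rewrite scalerA -exprD => <-; exists (l + j)%N.
have [s ms nPs] := prime_neq_local noethR localR pP Pm.
move=> dense.
(* An entry of the all-ones vector would put 1 in [m]: entries of [w *m A] lie in [m], and those of
   [t] lie in [P], being killed by powers of an [s] outside [P]. *)
have : subm_add (range (mulmxr A)) (torsion_part m _) (const_mx 1 : 'rV_n) by rewrite dense.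
case=> _ [t [[w _ <-] Tt /rowP/(_ (Ordinal n_gt0))]]; rewrite !mxE => one.
apply: (local_proper localR); rewrite one; apply: (@submD _ R^o) => //.
  by apply: (@subm_sum _ R^o) => // j _; apply: idealM.
have [j /rowP/(_ (Ordinal n_gt0))] := Tt s ms; rewrite !mxE => st0.
apply: (prime_sub_local noethR localR pP); have /primeP[sP _ Pp] := pP.
have : P (s ^+ j * t 0 (Ordinal n_gt0)) by rewrite st0; apply: sub0m sP.
by case/Pp => // /(primeX pP).
Qed.

(** * Eventual positivity of the alternating sums *)

Section EventualRank.
Variables (R : comNzRingType) (m : set R).
Hypotheses (noethR : noetherian_ring R) (localR : local_ring m).
Variables (beta : nat -> nat) (D : forall i, 'M[R]_(beta i.+1, beta i)).
Hypothesis D_exact : forall i (v : 'rV_(beta i.+1)),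
  v *m D i = 0 <-> exists w, v = w *m D i.+1.
Hypothesis D_minimal : forall i a b, m (D i a b).
Hypothesis D_torsion : forall s, m s ->
  exists k, forall v : 'rV_(beta 0), exists w, s ^+ k *: v = w *m D 0.
Hypothesis D_neq0 : forall i, D i <> 0.
Variable P : set R.
Hypotheses (pP : prime_ideal P) (P_neq : P <> m).

Let r := alt_rank beta.
Let rowspace i : set 'rV_(beta i) := range (mulmxr (D i) : 'rV_(beta i.+1) -> _).

Let rD i : (r i.+1 + r i)%N = beta i.+1 := alt_rankD noethR localR D_exact D_torsion i pP P_neq.

Let beta_gt0 i : (0 < beta i)%N.
Proof.
rewrite lt0n; apply/eqP => b0; apply: (D_neq0 (i := i)); apply/matrixP => a j.
by have := ltn_ord j; rewrite {2}b0.
Qed.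

Let rowspace_submodule i : submodule (@rowspace i).
Proof. by apply: image_submodule; apply: submoduleT. Qed.

Let rowspace_torsion i (v : 'rV_(beta i)) : r i = 0%N -> rowspace v -> torsion_part m _ v.
Proof.
move=> ri [w _ <-] s ms.
have [k Hk] := alt_rank0_torsion noethR localR D_exact D_torsion ri ms.
by exists k; rewrite /= scalemxAr Hk mulmx0.
Qed.

Let rowspace_bounded i : r i = 0%N -> bounded_length [set 0] (@rowspace i).
Proof.
move=> ri; apply: (bounded_length_fg noethR localR (g := fun a => row a (D i))).
- exact: rowspace_submodule.
- move=> a s ms; apply: (rowspace_torsion ri) => //.
  by exists (delta_mx 0 a) => //=; rewrite -rowE.
- by move=> v [w _ <-]; exists (w 0); rewrite /= mulmx_sum_row.
Qed.

(** [rowspace i.+2] is the kernel of [D i.+1], and [D i] identifies the cokernel of [D i.+1] with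
    [rowspace i]; the two vanishing ranks make [D i.+1] square. *)
Let rowspace_chain i k : r i = 0%N -> r i.+2 = 0%N -> chain [set 0] (@rowspace i.+2) k ->
  exists2 l, (k < l)%N & chain [set 0] (@rowspace i) l.
Proof.
move=> ri ri2.
have E : beta i.+2 = beta i.+1 by rewrite -(rD i.+1) -(rD i) ri ri2 addn0.
have -> : @rowspace i.+2 = [set v | v *m D i.+1 = 0].
  apply/seteqP; split=> [_ [w _ <-]|v /D_exact[w ->]]; last by exists w.
  by apply/D_exact; exists w.
have kerT (v : 'rV_(beta i.+2)) : v *m D i.+1 = 0 -> torsion_part m _ v.
  by move=> /D_exact[w ->]; apply: (rowspace_torsion ri2); exists w.
move=> /(square_matrix_chain noethR localR pP P_neq E (beta_gt0 _) (@D_minimal _) kerT)[l ltkl chl].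
exists l => //; have := @chain_image _ _ _ (mulmxr (D i)) _ _ _ _ chl.
have -> : [set mulmxr (D i) x | x in range (mulmxr (D i.+1) : 'rV_(beta i.+2) -> _)] = [set 0].
  apply/seteqP; split=> [_ [_ [w _ <-] <-]|_ ->]; first by apply/D_exact; exists w.
  by exists 0; [exists 0 => //; apply: mul0mx|apply: mul0mx].
by apply=> v /D_exact[w ->]; exists w.
Qed.

(** Coming back from a far index, every step by two lengthens the chain, so [rowspace i] would have
    arbitrarily long chains. *)
Let not_always_r0 i : (forall k, r (i + k.*2) = 0%N) -> False.
Proof.
move=> r0; have [b Hb] : bounded_length [set 0] (@rowspace i).
  by apply: rowspace_bounded; rewrite -[i]addn0 (r0 0%N).
suff /(_ b.+1)[n ltbn /Hb] : forall c, exists2 n, (c <= n)%N & chain [set 0] (@rowspace i) n.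
  by rewrite leqNgt ltbn.
move=> c; elim: c i r0 {b Hb} => [|c IH] i r0.
  have sR := @rowspace_submodule i.
  have [|n ch] := chain_exists (submodule0 _) sR; last by exists n.
  by move=> _ ->; apply: sub0m.
have [|n lecn ch] := IH i.+2.
  by move=> k; have := r0 k.+1; rewrite doubleS !addnS.
have [||l ltnl chl] := rowspace_chain _ _ ch; last first.
- by exists l => //; apply: leq_ltn_trans ltnl.
- by have := r0 1%N; rewrite !addnS addn0.
- by have := r0 0%N; rewrite addn0.
Qed.

(** On each parity class [r] is eventually non-decreasing and not always zero, so it stays positive
    after a nonzero value. *)
Lemma alt_rank_eventually_pos :
  (exists N, forall i, (N <= i)%N -> (beta i <= beta i.+1)%N) ->
  exists N, forall i, (N <= i)%N -> alt_rank beta i <> 0%N.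
Proof.
move=> [N mono].
have mono2 i : (N <= i)%N -> (r i <= r i.+2)%N.
  move=> leNi; have := mono i.+1 (leqW leNi).
  by rewrite -(rD i) -(rD i.+1) [leqRHS]addnC leq_add2l.
have pos i : (N <= i)%N -> exists k, forall l, (k <= l)%N -> r (i + l.*2) <> 0%N.
  move=> leNi; have /existsNP[k rk] := fun r0 => @not_always_r0 i r0.
  exists k => l /subnKC <-; elim: (l - k)%N => [|d IH]; first by rewrite addn0.
  rewrite addnS doubleS !addnS => rS; apply: IH; apply/eqP; rewrite -leqn0 -rS.
  by apply: mono2; apply: leq_trans leNi _; apply: leq_addr.
have [k Hk] := pos N (leqnn N); have [l Hl] := pos N.+1 (leqnSn N).
(* Half of [i - N], rounded down, is then at least [k] and [l]; the parity of [i - N] selects the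
   class. *)
exists (N + (maxn k l).*2.+1)%N => i lei.
have leNi : (N <= i)%N by apply: leq_trans (leq_addr _ _) lei.
rewrite -(subnKC leNi) -[(i - N)%N]odd_double_half.
have le2 : (maxn k l <= (i - N)./2)%N.
  rewrite -leq_double -ltnS; apply: leq_trans (_ : _ <= i - N)%N _.
    by rewrite leq_subRL.
  by rewrite -{1}[(i - N)%N]odd_double_half addnC -addn1 leq_add2l leq_b1.
case: odd; last by apply: Hk; apply: leq_trans le2; apply: leq_maxl.
by rewrite addnA addn1; apply: Hl; apply: leq_trans le2; apply: leq_maxr.
Qed.

End EventualRank.

(** * Free resolutions and matrices *)

Section FreeModules.
Variable R : comNzRingType.

Lemma free_projective (G : lmodType R) n : free_of_rank G n -> projective G.
Proof.
move=> [e [e' eK e'K]] A B f g f_surj.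
have e'_lin : linear e' by move=> a u v; apply: (can_inj eK); rewrite linearP !e'K.
have fb j : exists b, f b = g (e (delta_mx 0 j)).
  have : range f (g (e (delta_mx 0 j))) by rewrite f_surj.
  by case=> b _ fb; exists b.
have [b Hb] := choice fb.
pose h x := \sum_j e' x 0 j *: b j.
have h_lin : linear h.
  move=> a u v; rewrite /h scaler_sumr -big_split; apply: eq_bigr => j _ /=.
  by rewrite e'_lin !mxE scalerDl scalerA.
pose hL : {linear G -> A} := HB.pack h (GRing.isLinear.Build _ _ _ _ h h_lin).
exists hL => x; rewrite /= /h linear_sum -[in RHS](e'K x) [in RHS](row_sum_delta (e' x)).
rewrite !linear_sum; apply: eq_bigr => j _.
by rewrite !linearZ Hb.
Qed.

Lemma matrix_of_linear (V W : lmodType R) n p (e : {linear 'rV[R]_n -> V})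
    (d : {linear 'rV[R]_p -> W}) (f : {linear W -> V}) :
  bijective e -> exists D : 'M[R]_(p, n), forall w, e (w *m D) = f (d w).
Proof.
move=> [e' eK e'K]; exists (\matrix_a e' (f (d (delta_mx 0 a)))) => w.
rewrite mulmx_sum_row [in RHS](row_sum_delta w) !linear_sum; apply: eq_bigr => a _.
by rewrite rowK !linearZ /= e'K.
Qed.

Lemma ann_submodule (V : lmodType R) (N : set V) : submodule (ann N : set R^o).
Proof.
apply/submoduleP; split=> [x _|a u v Nu Nv x Nx]; first exact: scale0r.
by rewrite scalerDl -scalerA Nu // Nv // scaler0 addr0.
Qed.

End FreeModules.

Section Resolution.
Variables (R : comNzRingType) (m : set R) (M : lmodType R).
Hypotheses (noethR : noetherian_ring R) (localR : local_ring m).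
Variables (F : resolution M) (beta : nat -> nat).
Hypothesis minF : minimal_free_resolution m F beta.

Lemma resolution_matrices : exists (e : forall i, {linear 'rV[R]_(beta i) -> term F i})
    (D : forall i, 'M[R]_(beta i.+1, beta i)),
  (forall i, bijective (e i)) /\ forall i w, e i (w *m D i) = diff F i (e i.+1 w).
Proof.
have [frF _] := minF.
pose e i := projT1 (cid (frF i)); have e_bij i : bijective (e i) := projT2 (cid (frF i)).
pose D i := cid (matrix_of_linear (e i.+1) (diff F i) (e_bij i)).
by exists e, (fun i => projT1 (D i)); split=> // i; apply: (projT2 (D i)).
Qed.

Variables (e : forall i, {linear 'rV[R]_(beta i) -> term F i})
  (D : forall i, 'M[R]_(beta i.+1, beta i)).
Hypotheses (e_bij : forall i, bijective (e i))
  (eD : forall i w, e i (w *m D i) = diff F i (e i.+1 w)).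

Let e_inj i : injective (e i) := bij_inj (e_bij i).

Let e_surj i x : exists v, e i v = x.
Proof. by have [e' _ eK] := e_bij i; exists (e' x). Qed.

Lemma matrix_exact i (v : 'rV_(beta i.+1)) : v *m D i = 0 <-> exists w, v = w *m D i.+1.
Proof.
have -> : v *m D i = 0 <-> range (diff F i.+1) (e i.+1 v).
  rewrite diff_exact /= -eD; split=> [->|/eqP]; first by rewrite linear0.
  by rewrite -(linear0 (e i)) => /eqP /e_inj.
split=> [[y _]|[w ->]]; last by rewrite eD; exists (e i.+2 w).
by have [w <-] := e_surj y; rewrite -eD => /e_inj <-; exists w.
Qed.

(** Elements of $\mathfrak m G_i$ have coordinates in [m] with respect to any basis. *)
Lemma matrix_minimal i a b : m (D i a b).
Proof.
have sm := local_submodule localR.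
have [_ /(_ i (diff F i (e i.+1 (delta_mx 0 a))))] := minF; case.
  by exists (e i.+1 (delta_mx 0 a)).
move=> n [c [v [mc E]]]; have [u Hu] := choice (fun j => e_surj (v j)).
have : delta_mx 0 a *m D i = \sum_j c j *: u j.
  apply: e_inj; rewrite eD E linear_sum; apply: eq_bigr => j _.
  by rewrite linearZ Hu.
rewrite -rowE => /rowP/(_ b); rewrite mxE summxE => ->.
by apply: (@subm_sum _ R^o) => // j _; rewrite mxE mulrC; apply: idealM.
Qed.

Lemma matrix_torsion s : finite_length [set: M] -> m s ->
  exists k, forall v : 'rV_(beta 0), exists w, s ^+ k *: v = w *m D 0.
Proof.
move=> lenM /(finite_length_torsion noethR localR lenM)[k Hk]; exists k => v.
have : range (diff F 0) (s ^+ k *: e 0%N v) by rewrite aug_exact /= linearZ /= Hk.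
case=> y _; have [w <-] := e_surj y; rewrite -eD -linearZ => /e_inj <-.
by exists w.
Qed.

Lemma ann_syzygy i a : ann (syzygy F i.+1) a <-> a *: D i = 0.
Proof.
split=> [ann_a|aD x [y _ <-]].
  apply/row_matrixP => j; apply: e_inj; rewrite linearZ linearZ /= row0 linear0.
  by rewrite rowE eD; apply: ann_a; exists (e i.+1 (delta_mx 0 j)).
have [w <-] := e_surj y; rewrite -eD -linearZ.
by rewrite [a *: _]scalemxAr aD mulmx0 linear0.
Qed.

(** A zero differential would make [F] itself a finite projective resolution. *)
Lemma matrix_neq0 i : ~ finite_proj_dim M -> D i <> 0.
Proof.
move=> pdM Di; apply: pdM; exists F, i; split=> [j|j ltij].
  by have [frF _] := minF; apply: free_projective (frF j).
(* By exactness the all-ones vector is in the image of [D k.+1], whose entries lie in [m]; a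
   positive rank would put 1 in [m]. *)
have D0 k : D k = 0 -> beta k.+1 = 0%N.
  move=> Dk; apply/eqP; rewrite -leqn0 leqNgt; apply/negP => b_gt0.
  have /matrix_exact[w /rowP/(_ (Ordinal b_gt0))] : (const_mx 1 : 'rV_(beta k.+1)) *m D k = 0.
    by rewrite Dk mulmx0.
  rewrite !mxE => one; apply: (local_proper localR); rewrite one.
  apply: (@subm_sum _ R^o); first exact: local_submodule.
  by move=> l _; apply: idealM; [exact: local_submodule|exact: matrix_minimal].
(* A zero rank makes the next matrix empty, hence zero, so the vanishing propagates. *)
have bj : beta j = 0%N.
  rewrite -(subnKC ltij) addSn; apply: (D0); elim: (j - i.+1)%N => [|d IH]; first by rewrite addn0.
  by rewrite addnS; apply/matrixP => a b; have := ltn_ord b; rewrite {2}(D0 _ IH).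
apply/seteqP; split=> // x _; have [v <-] := e_surj x; rewrite /=.
rewrite (_ : v = 0) ?linear0 //; apply/rowP => l.
by have := ltn_ord l; rewrite {2}bj.
Qed.

End Resolution.

(** * The dimension of high syzygies *)

Theorem proposition5p7 (R : comNzRingType) (m : set R)
    (noethR : noetherian_ring R) (localR : local_ring m)
    (M : lmodType R)
    (lenM : finite_length [set: M])
    (pdM : ~ finite_proj_dim M)
    (F : resolution M) (beta : nat -> nat)
    (minF : minimal_free_resolution m F beta)
    (beta_mono : exists N : nat, forall i : nat, (N <= i)%N ->
      (beta i <= beta i.+1)%N) :
  (exists N : nat, forall i : nat, (N <= i)%N ->
     exists p : set R, minimal_prime p /\ dim_mod (syzygy F i) = dim_quot p) /\
  ((0 < krull_dim R)%E ->
     ~ (forall N : nat, exists i : nat,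
          (N <= i)%N /\ finite_length (syzygy F i))).
Proof.
have [e [D [e_bij eD]]] := resolution_matrices minF.
have D_exact := matrix_exact e_bij eD.
have D_minimal := matrix_minimal localR minF e_bij eD.
have D_torsion s := matrix_torsion noethR localR e_bij eD lenM (s := s).
have D_neq0 i := matrix_neq0 localR minF e_bij eD (i := i) pdM.
have annE := ann_syzygy e_bij eD.
have rank_pos p : prime_ideal p -> p <> m -> exists N : nat, forall i, (N <= i)%N ->
    alt_rank beta i <> 0%N.
  move=> pp pm.
  exact: (alt_rank_eventually_pos noethR localR D_exact D_minimal D_torsion D_neq0 pp pm).
have ann_prime i p a : alt_rank beta i <> 0%N -> prime_ideal p -> p <> m ->
    ann (syzygy F i.+1) a -> p a.
  move=> /eqP ri pp pm /annE aD.
  exact: (alt_rank_gt0_ann noethR localR D_exact D_torsion ri aD pp pm).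
have ann_proper i : is_proper_ideal (ann (syzygy F i.+1)).
  apply/idealP; split; first exact: ann_submodule.
  by move=> /annE; rewrite scale1r; apply: D_neq0.
split.
(* The ranks control annihilators through primes other than [m]. If there are none, [m] is the only
   prime and contains the proper annihilator. *)
- have [[p pp pm]|all_m] := pselect (exists2 p, prime_ideal p & p <> m).
    have [N rN] := rank_pos p pp pm; exists N.+1 => -[//|i]; rewrite ltnS => leNi.
    apply: dim_quot_minimal_prime => // q [pq minq] a.
    apply: ann_prime => //; first exact: rN.
    (* A minimal prime equal to [m] would contain [p], hence equal it. *)
    move=> qm; apply: pm; rewrite -qm; apply: minq => //.
    by rewrite qm; apply: (prime_sub_local noethR localR).
  exists 1%N => -[//|i] _; apply: dim_quot_minimal_prime => // q [pq _].
  have -> : q = m by apply: contrapT => qm; apply: all_m; exists q.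
  by have /idealP[sI I1] := ann_proper i; apply: (local_sub noethR localR).
(* Finite length would make a power of some [s] outside [p] annihilate the syzygy, while positive
   rank puts its annihilator inside [p]. *)
- move=> /(exists_prime_neq m)[p pp pm] high.
  have [N rN] := rank_pos p pp pm.
  have [[|i] [leNi leni]] := high N.+1; first by [].
  have [s ms nps] := prime_neq_local noethR localR pp pm.
  have [k Hk] := finite_length_torsion noethR localR leni ms.
  apply: nps; apply: (primeX pp (k := k)); apply: (ann_prime i) => //; exact: rN.
Qed.
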